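(* Let $D_{2p^2}=\langle a,b: a^{p^2}=b^2=1, bab=a^{-1}\rangle$ be the dihedral group of order $2p^2$, where $p$ is a prime. Then \[ \mathcal{B}(D_{2p^2})=K_2\sqcup p^2K_{1,3}\sqcup K_{1,p^2-1}\sqcup K_{1,p^4-p^2}\sqcup pK_{1,3p(p-1)}\sqcup K_{1,3p^2(p^2-p)}. \]
   Context: For a group $G$, let $L(G)$ be the set of all subgroups of $G$. The graph $\mathcal{B}(G)$ is the simple undirected bipartite graph with vertex set the disjoint union $V(\mathcal{B}(G)) = (G\times G) \sqcup L(G)$, in which $(a,b)\in G\times G$ and $H \in L(G)$ are adjacent if and only if $H = \langle a,b\rangle$, and there are no other edges. $K_n$ is the complete graph on $n$ vertices, $K_{1,n}$ is the star on $n+1$ vertices, $\sqcup$ denotes disjoint union of graphs, and $mK_{1,n}$ denotes the disjoint union of $m$ copies of $K_{1,n}$. Equality of graphs means isomorphism. *)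

(* Defs.v *)
From mathcomp Require Import all_boot all_fingroup all_solvable.
Set Implicit Arguments.
Unset Strict Implicit.
Unset Printing Implicit Defensive.

Local Open Scope group_scope.

Record sgraph := SGraph {
  vertex :> finType;
  adj : rel vertex;
  adj_sym : symmetric adj;
  adj_irr : irreflexive adj
}.

Definition giso (X Y : sgraph) : Prop :=
  exists2 f : X -> Y, bijective f & forall x y : X, adj (f x) (f y) = adj x y.

Definition complete_adj (n : nat) : rel 'I_n := fun i j => i != j.

Lemma complete_sym (n : nat) : symmetric (@complete_adj n).
Proof. by move=> i j; rewrite /complete_adj eq_sym. Qed.

Lemma complete_irr (n : nat) : irreflexive (@complete_adj n).
Proof. by move=> i; rewrite /complete_adj eqxx. Qed.

Definition complete (n : nat) : sgraph :=
  SGraph (@complete_sym n) (@complete_irr n).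

Definition bicomplete_adj (m n : nat) : rel ('I_m + 'I_n)%type := fun u v =>
  match u, v with
  | inl _, inr _ | inr _, inl _ => true
  | _, _ => false
  end.

Lemma bicomplete_sym (m n : nat) : symmetric (@bicomplete_adj m n).
Proof. by move=> [i|i] [j|j]. Qed.

Lemma bicomplete_irr (m n : nat) : irreflexive (@bicomplete_adj m n).
Proof. by move=> [i|i]. Qed.

Definition bicomplete (m n : nat) : sgraph :=
  SGraph (@bicomplete_sym m n) (@bicomplete_irr m n).

Definition star (n : nat) : sgraph := bicomplete 1 n.

Definition gunion_adj (X Y : sgraph) : rel (X + Y)%type := fun u v =>
  match u, v with
  | inl x, inl x' => adj x x'
  | inr y, inr y' => adj y y'
  | _, _ => false
  end.

Lemma gunion_sym (X Y : sgraph) : symmetric (@gunion_adj X Y).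
Proof. by move=> [x|y] [x'|y'] //=; rewrite adj_sym. Qed.

Lemma gunion_irr (X Y : sgraph) : irreflexive (@gunion_adj X Y).
Proof. by move=> [x|y] /=; rewrite adj_irr. Qed.

Definition gunion (X Y : sgraph) : sgraph :=
  SGraph (@gunion_sym X Y) (@gunion_irr X Y).

Definition copies_adj (m : nat) (X : sgraph) : rel ('I_m * X)%type :=
  fun u v => (u.1 == v.1) && adj u.2 v.2.

Lemma copies_sym (m : nat) (X : sgraph) : symmetric (@copies_adj m X).
Proof. by move=> u v; rewrite /copies_adj eq_sym adj_sym. Qed.

Lemma copies_irr (m : nat) (X : sgraph) : irreflexive (@copies_adj m X).
Proof. by move=> u; rewrite /copies_adj adj_irr andbF. Qed.

Definition copies (m : nat) (X : sgraph) : sgraph :=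
  SGraph (@copies_sym m X) (@copies_irr m X).

Declare Scope sgraph_scope.
Delimit Scope sgraph_scope with SG.
Bind Scope sgraph_scope with sgraph.
Notation "X |+| Y" := (gunion X Y)
  (at level 50, left associativity) : sgraph_scope.

Definition pair_vertex (gT : finGroupType) (G : {group gT}) : finType :=
  ([subg G] * [subg G])%type.

Definition subgroup_vertex (gT : finGroupType) (G : {group gT}) : finType :=
  {H : {group gT} | H \subset G}.

Definition generates (gT : finGroupType) (G : {group gT})
    (ab : pair_vertex G) (H : subgroup_vertex G) : bool :=
  val H == <<[set sgval ab.1; sgval ab.2]>> :> {set gT}.

Definition bgraph_adj (gT : finGroupType) (G : {group gT}) :
    rel (pair_vertex G + subgroup_vertex G)%type := fun u v =>
  match u, v with
  | inl ab, inr H | inr H, inl ab => generates ab H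
  | _, _ => false
  end.

Lemma bgraph_sym (gT : finGroupType) (G : {group gT}) :
  symmetric (@bgraph_adj gT G).
Proof. by move=> [x|x] [y|y]. Qed.

Lemma bgraph_irr (gT : finGroupType) (G : {group gT}) :
  irreflexive (@bgraph_adj gT G).
Proof. by move=> [x|x]. Qed.

Definition bgraph (gT : finGroupType) (G : {group gT}) : sgraph :=
  SGraph (@bgraph_sym gT G) (@bgraph_irr gT G).

(* Main.v *)
(** Every pair is joined to exactly one subgroup, so [bgraph G] is a disjoint
    union of stars, one for each subgroup [H], with as many leaves as there are
    pairs generating [H].  Such a graph is determined by its family of star
    sizes.  A subgroup of the dihedral group is either a rotation group of order
    [p ^ k], or such a group [B] extended by a reflection, with [p ^ (2 - k)]
    possible extensions.  A pair generates the latter iff it consists of a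
    generator of [B] and a reflection, in either order, or of two reflections
    whose product generates [B]: [3 |B| totient |B|] pairs in all. *)
Require Import Defs.
From mathcomp Require Import all_boot all_fingroup all_solvable.

Set Implicit Arguments.
Unset Strict Implicit.
Unset Printing Implicit Defensive.

Local Open Scope group_scope.

(** * Star forests and their isomorphism *)

(** [ctr] gives the centre of each star and [root] the star of each vertex. The exclusive or says
    that exactly one end of an edge is a centre; the successor in [(n i).+1] counts the centre
    besides the leaves. *)
Definition star_forest (X : sgraph) (I : finType) (n : I -> nat) : Prop :=
  exists (ctr : I -> X) (root : X -> I),
  [/\ cancel ctr root,
      forall x y : X, adj x y = (root x == root y) &&
        ((x == ctr (root x)) (+) (y == ctr (root y)))
    & forall i, #|[set x | root x == i]| = (n i).+1].

Lemma star_forest_star (n : nat) : star_forest (star n) (fun _ : unit => n).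
Proof.
exists (fun _ => inl ord0), (fun _ => tt); split=> [[] //||i].
  by case=> [x|x] [y|y] //=; rewrite ?(ord1 x) ?(ord1 y) ?eqxx.
rewrite (_ : [set x | _] = setT); last by apply/setP=> x; rewrite !inE.
by rewrite cardsT card_sum !card_ord.
Qed.

Lemma star_forest_K2 : star_forest (complete 2) (fun _ : unit => 1%N).
Proof.
exists (fun _ => ord0), (fun _ => tt); split=> [[] //||i].
  by case=> [[|[|x]] hx] [[|[|y]] hy].
rewrite (_ : [set x | _] = setT); last by apply/setP=> x; rewrite !inE.
by rewrite cardsT card_ord.
Qed.

Definition sum_size (I J : Type) (n : I -> nat) (m : J -> nat) (s : I + J) :=
  match s with inl i => n i | inr j => m j end.

Lemma star_forest_gunion (X Y : sgraph) (I J : finType)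
    (n : I -> nat) (m : J -> nat) :
  star_forest X n -> star_forest Y m ->
  star_forest (gunion X Y) (sum_size n m).
Proof.
case=> cX [rX [cXK adjX szX]] [cY [rY [cYK adjY szY]]].
pose c (s : I + J) : X + Y := match s with inl i => inl (cX i) | inr j => inr (cY j) end.
pose r (s : X + Y) : I + J := match s with inl i => inl (rX i) | inr j => inr (rY j) end.
exists c, r; split=> [[i|j]|[x|x] [y|y]|[i|j]] //=; rewrite ?cXK ?cYK //.
- rewrite -szX -(card_imset _ (@inl_inj X Y)); apply: eq_card => -[x|y].
    by rewrite mem_imset ?inE //; apply: inl_inj.
  by rewrite inE /=; apply/esym/imsetP => -[].
rewrite -szY -(card_imset _ (@inr_inj X Y)); apply: eq_card => -[x|y].
  by rewrite inE /=; apply/esym/imsetP => -[].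
by rewrite mem_imset ?inE //; apply: inr_inj.
Qed.

Lemma star_forest_copies (k : nat) (X : sgraph) (I : finType) (n : I -> nat) :
  star_forest X n -> star_forest (copies k X) (fun s : 'I_k * I => n s.2).
Proof.
case=> c [r [cK adjX szX]].
exists (fun s => (s.1, c s.2)), (fun u => (u.1, r u.2)).
split=> [[i j]|[i x] [j y]|[i j]] /=; first by rewrite cK.
  by rewrite /copies_adj /= adjX !xpair_eqE !eqxx /= andbA.
rewrite -szX -(card_imset [set x | r x == j] (f := fun x => (i, x))); last first.
  by move=> x y [].
apply: eq_card => -[i' x]; rewrite inE /= xpair_eqE.
apply/andP/imsetP => [[/eqP-> rx]|[y]]; first by exists x; rewrite ?inE.
by rewrite inE => ry [-> ->].
Qed.

Lemma star_forest_reindex (X : sgraph) (I J : finType)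
    (n : I -> nat) (m : J -> nat) (phi : J -> I) :
  bijective phi -> (forall j, n (phi j) = m j) ->
  star_forest X n -> star_forest X m.
Proof.
case=> psi phiK psiK nm [c [r [cK adjX szX]]].
exists (c \o phi), (psi \o r); split=> [j|x y|j] /=; first by rewrite cK phiK.
  by rewrite !psiK (can_eq psiK) adjX.
rewrite -nm -szX; apply: eq_card => x.
by rewrite !inE -(can_eq phiK) psiK.
Qed.

(* Two stars are matched by listing each with its centre first. *)
Lemma star_forest_iso (X Y : sgraph) (I : finType) (n : I -> nat) :
  star_forest X n -> star_forest Y n -> giso X Y.
Proof.
case=> cX [rX [cXK adjX szX]] [cY [rY [cYK adjY szY]]].
pose L (Z : sgraph) (c : I -> Z) (r : Z -> I) i :=
  c i :: enum ([set z | r z == i] :\ c i).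
have mL Z c r i z : cancel c r -> (z \in L Z c r i) = (r z == i).
  move=> cK; rewrite inE mem_enum !inE.
  by case: eqP => //= ->; rewrite cK eqxx.
have uL Z c r i : uniq (L Z c r i).
  by rewrite /= mem_enum !inE eqxx enum_uniq.
have sL (Z : sgraph) (c : I -> Z) (r : Z -> I) i : cancel c r ->
    #|[set z | r z == i]| = (n i).+1 -> size (L Z c r i) = (n i).+1.
  by move=> cK; rewrite /= -cardE (cardsD1 (c i)) inE cK eqxx add1n.
(* Each vertex goes to the vertex at the same position in the list of the star with the same index.
   The two lists have equal length, so the default of [nth] is never reached. *)
pose tr (Z W : sgraph) c r c' r' (z : Z) : W :=
  nth (c' (r z)) (L W c' r' (r z)) (index z (L Z c r (r z))).
have trr (Z W : sgraph) c r c' r' z : cancel c r -> cancel c' r' ->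
    (forall i, #|[set z | r z == i]| = (n i).+1) ->
    (forall i, #|[set z | r' z == i]| = (n i).+1) ->
    r' (tr Z W c r c' r' z) = r z.
  move=> cK cK' sz sz'; apply/eqP; rewrite -(mL _ c') //.
  apply: mem_nth; rewrite sL // -(sL Z c r) // index_mem mL //.
have trK (Z W : sgraph) c r c' r' : cancel c r -> cancel c' r' ->
    (forall i, #|[set z | r z == i]| = (n i).+1) ->
    (forall i, #|[set z | r' z == i]| = (n i).+1) ->
    cancel (tr Z W c r c' r') (tr W Z c' r' c r).
  move=> cK cK' sz sz' z; rewrite /(tr W) trr // index_uniq //.
    by rewrite nth_index // mL.
  by rewrite sL // -(sL Z c r) // index_mem mL.
have trc (Z W : sgraph) c r c' r' i : cancel c r ->
    tr Z W c r c' r' (c i) = c' i.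
  by move=> cK; rewrite /tr cK /= eqxx.
pose f := tr X Y cX rX cY rY.
have fK : cancel f (tr Y X cY rY cX rX) by apply: trK.
exists f; first by exists (tr Y X cY rY cX rX) => //; apply: trK.
have rf x : rY (f x) = rX x by apply: trr.
(* Centres head their lists, so [f] preserves and reflects being a centre; with [rf] this determines
   adjacency. *)
have fc x : (f x == cY (rX x)) = (x == cX (rX x)).
  by rewrite -[RHS](can_eq fK) [f (cX _)]trc.
by move=> x y; rewrite adjY !rf !fc -adjX.
Qed.

(** * The bipartite graph of a group as a star forest *)

Definition generating_pairs (gT : finGroupType) (H : {set gT}) :
  {set gT * gT} := [set u | <<[set u.1; u.2]>> == H].

Lemma star_forest_bgraph (gT : finGroupType) (G : {group gT}) :
  star_forest (bgraph G)
    (fun H : subgroup_vertex G => #|generating_pairs (val H)|).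
Proof.
have sG (u : pair_vertex G) : <<[set sgval u.1; sgval u.2]>> \subset G.
  by rewrite gen_subG subUset !sub1set !subgP.
pose gen u : subgroup_vertex G := Sub <<[set sgval u.1; sgval u.2]>>%G (sG u).
pose r (s : bgraph G) : subgroup_vertex G :=
  match s with inl u => gen u | inr H => H end.
have genP u H : generates u H = (gen u == H).
  by rewrite /generates eq_sym -val_eqE.
exists (fun H => inr H), r; split=> //.
  move=> [u|H] [v|K]; rewrite /= ?andbF //.
  - by rewrite genP eqxx andbT.
  - by rewrite genP eqxx addbF eq_sym andbT.
  by rewrite !eqxx andbF.
move=> H; rewrite (cardsD1 (inr H)) inE eqxx add1n; congr _.+1.
(* A pair of [gT] that generates [H] lies in [H], hence in [G], so counting in [gT] or in [G] gives
   the same number. *)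
pose v (u : pair_vertex G) := (sgval u.1, sgval u.2).
have injv : injective v.
  by move=> [x y] [x' y'] [/val_inj-> /val_inj->].
have -> : generating_pairs (val H) = v @: [set u | generates u H].
  apply/setP=> -[x y]; rewrite inE /=; apply/idP/imsetP => [/eqP xyH|[u]].
    have [xG yG]: x \in G /\ y \in G.
      by split; apply: (subsetP (valP H)); rewrite -xyH mem_gen // !inE eqxx ?orbT.
    exists (subg G x, subg G y); last by rewrite /v !subgK.
    by rewrite inE /generates /= !subgK // xyH.
  by rewrite inE /generates eq_sym => uH [-> ->].
rewrite card_imset // -(card_imset _ (@inl_inj (pair_vertex G) (subgroup_vertex G))).
apply: eq_card => -[u|K].
  by rewrite !inE mem_imset ?inE ?genP //; apply: inl_inj.
rewrite !inE /= (inj_eq (@inr_inj _ _)) andNb.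
by apply/esym/imsetP => -[].
Qed.

(** * Structure of the dihedral group from its presentation *)

Lemma invg_expg2 (gT : finGroupType) (t : gT) : t ^+ 2 = 1 -> t^-1 = t.
Proof. by move=> t2; apply/eqP; rewrite eq_invg_mul -(expgS t 1) t2. Qed.

Lemma mem_cycle_expg2 (gT : finGroupType) (t v : gT) :
  t ^+ 2 = 1 -> v \in <[t]> -> v = 1 \/ v = t.
Proof.
move=> t2 /cycleP[i ->]; rewrite -(odd_double_half i) expgD -mul2n expgM.
by rewrite t2 expg1n mulg1; case: (odd i); [right; rewrite expg1 | left].
Qed.

(** The relations only bound the orders of [a] and [b] from above. Equality follows from a lower
    bound on the order of [G], which maps onto the concrete dihedral group of order [q.*2]. *)
Lemma isoGrp_dihedral_generators (q : nat) (gT : finGroupType) (G : {group gT}) :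
    1 < q ->
    G \isog Grp (a : b : a ^+ q, b ^+ 2, b * a * b = a^-1) ->
  exists a b, [/\ #[a] = q, b \in G :\: <[a]>, b ^+ 2 = 1, a ^ b = a^-1
    & <[a]> * <[b]> = G].
Proof.
move=> q_gt1 isoG.
have leG : q.*2 <= #|G|.
  rewrite -(card_dihedral q_gt1); apply: leq_homg; rewrite isoG.
  have /existsP[[x y] /=] := isoGrp_hom (Grp_dihedral q_gt1).
  case/eqP=> xyD xq y2 xy; apply/existsP; exists (x, y).
  by rewrite /= !xpair_eqE xyD xq y2 -xy conjgE (invg_expg2 y2) mulgA !eqxx.
have /existsP[[a b] /=] := isoGrp_hom isoG.
case/eqP=> abG aq b2 bab.
have ab : a ^ b = a^-1 by rewrite conjgE (invg_expg2 b2) mulgA.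
have nab : <[b]> \subset 'N(<[a]>).
  by rewrite cycle_subG inE -cycleJ ab cycleV.
have defG : <[a]> * <[b]> = G by rewrite -abG norm_joinEr.
have a_q : #[a] <= q by rewrite dvdn_leq ?order_dvdn ?aq // ltnW.
have b_2 : #[b] <= 2 by rewrite dvdn_leq ?order_dvdn ?b2.
exists a, b; split=> //.
(* Here [2q <= |G| <= #[a] #[b] <= 2 #[a]]. *)
- apply/eqP; rewrite eqn_leq a_q -(leq_pmul2r (ltn0Sn 1)) muln2.
  apply: leq_trans leG _; rewrite -defG.
  apply: leq_trans (_ : #[a] * #[b] <= _)%N; last by rewrite leq_mul2l b_2 orbT.
  by rewrite /order mul_cardG leq_pmulr ?cardG_gt0.
rewrite inE -[in X in _ && X]defG -{2}[b]mul1g mem_mulg ?group1 ?cycle_id // andbT.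
(* If [b] were a power of [a], then [G = <[a]>] would have at most [q < 2q] elements. *)
apply: contraL leG => ba; rewrite -ltnNge -defG mulGSid ?cycle_subG //.
by apply: leq_ltn_trans a_q _; rewrite -addnn -{1}[q]addn0 ltn_add2l ltnW.
Qed.

(** * Subgroups and generating pairs when involutions outside [A] invert [A] *)

Section InvertingCoset.

Variables (gT : finGroupType) (G A : {group gT}).
Hypotheses
  (invol : {in G :\: A, forall t, t ^+ 2 = 1})
  (invA : {in G :\: A & A, forall t x, x ^ t = x^-1})
  (genG : {in G :\: A, forall t, A * <[t]> = G}).

Lemma inverting_norm (K : {group gT}) t :
  K \subset A -> t \in G :\: A -> <[t]> \subset 'N(K).
Proof.
move=> sKA tGA; rewrite cycle_subG inE; apply/subsetP=> _ /imsetP[x xK ->].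
by rewrite invA ?groupV // (subsetP sKA).
Qed.

Lemma coset_TI t : t \in G :\: A -> A :&: <[t]> = 1.
Proof.
move=> tGA; rewrite setIC; apply: prime_TIg; last first.
  by rewrite cycle_subG; case/setDP: tGA.
rewrite -/#[t]; have -> // : #[t] = 2.
apply: nt_prime_order (invol tGA) _ => //.
by apply: contraTneq tGA => ->; rewrite inE group1.
Qed.

(** By Dedekind's law the intersection is [K] times [A :&: <[t]>], which is trivial. *)
Lemma joing_coset_cap (K : {group gT}) t :
  K \subset A -> t \in G :\: A -> A :&: (K <*> <[t]>) = K.
Proof.
move=> sKA tGA; rewrite norm_joinEr ?inverting_norm // setIC -group_modl //.
by rewrite setIC coset_TI // mulg1.
Qed.

(** Dedekind's law again, now with [A * <[t]> = G]. Thus a subgroup not inside [A] is determined by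
    its trace on [A] and any one of its elements outside [A]. *)
Lemma coset_joing_cap (H : {group gT}) t :
  H \subset G -> t \in H :\: A -> (A :&: H) <*> <[t]> = H.
Proof.
move=> sHG tHA; have tGA : t \in G :\: A by apply: subsetP tHA; apply: setSD.
have tH : t \in H by case/setDP: tHA.
rewrite norm_joinEr ?inverting_norm ?subsetIl // /= setIC group_modr ?cycle_subG //.
by rewrite genG //; apply/setIidPl.
Qed.

Lemma card_joing_coset (K : {group gT}) t :
  K \subset A -> t \in G :\: A -> #|K <*> <[t]>| = (#|K| * 2)%N.
Proof.
move=> sKA tGA; rewrite norm_joinEr ?inverting_norm // TI_cardMg; last first.
  by apply/trivgP; rewrite -(coset_TI tGA) setSI.
congr (_ * _)%N; apply: nt_prime_order (invol tGA) _ => //.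
by apply: contraTneq tGA => ->; rewrite inE group1.
Qed.

(** Since [G = A * <[y]>], one has [x = u * y] with [u] in [A], and [y ^+ 2 = 1]. *)
Lemma mul_coset x y : x \in G :\: A -> y \in G :\: A -> x * y \in A.
Proof.
move=> /setDP[xG xNA] yGA; move: xG xNA.
rewrite -(genG yGA) => /mulsgP[u v uA vy ->].
have [->|->] := mem_cycle_expg2 (invol yGA) vy; first by rewrite mulg1 uA.
move=> _.
by rewrite -mulgA -(expgS y 1) invol ?mulg1.
Qed.

Hypothesis cycA : cyclic A.

Lemma card_generators (K : {group gT}) :
  K \subset A -> #|[set z | generator K z]| = totient #|K|.
Proof.
by move=> sKA; have /cyclicP[x ->] := cyclicS sKA cycA; rewrite totient_gen cardsE.
Qed.

Lemma generator_sub (K : {group gT}) z : generator K z -> z \in K.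
Proof. by move/eqP->; apply: cycle_id. Qed.

(** Intersecting [<[z]> <*> <[t]>] with [A] returns [<[z]>], and joining [t] to [A :&: H] returns
    [H]. *)
Lemma generating_coset (H : {group gT}) z t :
    H \subset G -> z \in A -> t \in H :\: A ->
  (<<[set z; t]>> == H) = generator (A :&: H) z.
Proof.
move=> sHG zA tHA; have tGA : t \in G :\: A by apply: subsetP tHA; apply: setSD.
have -> : <<[set z; t]>> = <[z]> <*> <[t]> by rewrite joing_idl joing_idr.
apply/eqP/eqP => [<-|<-]; first by rewrite joing_coset_cap ?cycle_subG.
exact: coset_joing_cap.
Qed.

Lemma card_generating_pairs_coset (H : {group gT}) :
    H \subset G -> ~~ (H \subset A) ->
  #|generating_pairs H| = (3 * (#|A :&: H| * totient #|A :&: H|))%N.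
Proof.
move=> sHG /subsetPn[t tH tNA].
have tHA : t \in H :\: A by rewrite inE tNA.
have tGA : t \in G :\: A by apply: subsetP tHA; apply: setSD.
pose E := [set z | generator (A :&: H) z].
have sEA z : z \in E -> z \in A by rewrite inE => /generator_sub /setIP[].
have sEH z : z \in E -> z \in H by rewrite inE => /generator_sub /setIP[].
have sHG' s : s \in H :\: A -> s \in G :\: A.
  by apply: subsetP; apply: setSD.
pose P1 := setX E (H :\: A); pose P2 := setX (H :\: A) E.
(* The pairs of two reflections, as an injective image of [P1]: this gives their number, while
   [memP3] gives the test on [x * y^-1]. *)
pose P3 := (fun u => (u.1 * u.2, u.2)) @: P1.
have memP3 x y : ((x, y) \in P3) = (x * y^-1 \in E) && (y \in H :\: A).
  apply/imsetP/andP => [[[z s]] | [xyE yHA]].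
    by rewrite in_setX => /andP[zE sHA] [-> ->]; rewrite mulgK.
  by exists (x * y^-1, y); rewrite ?in_setX ?xyE //= mulgKV.
have genS x y : <<[set x; y]>> = <<[set y; x]>> by rewrite setUC.
have -> : generating_pairs H = P1 :|: P2 :|: P3.
  apply/setP=> -[x y]; rewrite inE !in_setU memP3 !in_setX /=.
  have [xyH | nxyH] := boolP ((x \in H) && (y \in H)); last first.
    have -> : (<<[set x; y]>> == H) = false.
      apply: contraNF nxyH => /eqP <-.
      by rewrite !mem_gen // !inE eqxx ?orbT.
    apply/esym/negbTE; apply: contra nxyH.
    move=> /orP[/orP[]|] /andP[].
    - by move=> /sEH-> /setDP[->].
    - by move=> /setDP[-> _] /sEH->.
    by move=> /sEH xyH /setDP[yH _]; rewrite yH -(mulgKV y x) groupM.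
  case/andP: xyH => xH yH; rewrite !in_setD xH yH !andbT.
  have [xA|xNA] := boolP (x \in A); have [yA|yNA] := boolP (y \in A) => /=.
  (* Two elements of [A] generate a subgroup of [A], which cannot contain [t]. *)
  - rewrite !andbF; apply: contraNF tNA => /eqP xyH.
    by apply: subsetP tH; rewrite -xyH gen_subG subUset !sub1set xA.
  - have yHA : y \in H :\: A by rewrite inE yNA.
    rewrite generating_coset //.
    have /negPf-> : x * y^-1 \notin E; last by rewrite andbT !orbF inE.
    by apply: contra yNA => /sEA; rewrite groupMl ?groupV.
  - have xHA : x \in H :\: A by rewrite inE xNA.
    by rewrite genS generating_coset // !inE ?andbF ?orbF.
  have yHA : y \in H :\: A by rewrite inE yNA.
  have xHA : x \in H :\: A by rewrite inE xNA.
  (* Replacing [x] by [x * y^-1], which lies in [A], reduces two reflections to the case of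
     [generating_coset]. *)
  have -> : <<[set x; y]>> = <<[set x * y^-1; y]>>.
    have m1 u v : u \in <<[set u; v]>> by rewrite mem_gen ?set21.
    have m2 u v : v \in <<[set u; v]>> by rewrite mem_gen ?set22.
    apply/eqP; rewrite eqEsubset !gen_subG !subUset !sub1set !m2 !andbT.
    by rewrite groupM ?groupV ?m1 ?m2 // -{1}(mulgKV y x) groupM ?m1 ?m2.
  rewrite generating_coset ?(invg_expg2 (invol (sHG' _ yHA))) ?mul_coset ?sHG' //.
  have /negPf-> : x \notin E by apply: contra xNA; apply: sEA.
  have /negPf-> : y \notin E by apply: contra yNA; apply: sEA.
  by rewrite !andbT inE.
have cardE : #|E| = totient #|A :&: H| by rewrite card_generators ?subsetIl.
(* [H] is [A :&: H] extended by the involution [t], so it has twice the order. *)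
have cardHA : #|H :\: A| = #|A :&: H|.
  apply/eqP; rewrite -(eqn_add2l #|H :&: A|) cardsID setIC addnn -muln2.
  by rewrite -(card_joing_coset (subsetIl A H) tGA) coset_joing_cap.
have injf : injective (fun u : gT * gT => (u.1 * u.2, u.2)).
  by move=> [x y] [x' y'] [+ yy]; rewrite yy => /mulIg->.
have TI13 : [disjoint P1 :|: P2 & P3].
  rewrite -setI_eq0; apply/eqP/setP=> -[x y].
  rewrite in_setI in_setU memP3 !in_setX in_set0; apply/negbTE.
  apply/negP=> /andP[/orP[] /andP[]]; last first.
    by move=> _ /sEA yA /andP[_ /setDP[_ /negP]].
  move=> /sEA xA /setDP[_ yNA] /andP[/sEA].
  by rewrite groupMl // groupV (negPf yNA).
have TI12 : [disjoint P1 & P2].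
  rewrite -setI_eq0; apply/eqP/setP=> -[x y].
  rewrite in_setI !in_setX in_set0; apply/negbTE.
  by apply/negP=> /andP[/andP[/sEA xA _] /andP[/setDP[_ /negP]]].
rewrite !cardsU (disjoint_setI0 TI13) (disjoint_setI0 TI12) !cards0 !subn0.
rewrite (card_imset _ injf) !cardsX cardE cardHA.
by rewrite [(totient _ * _)%N]mulnC !mulSn mul0n addn0 addnA.
Qed.

End InvertingCoset.

(** * Generating pairs of cyclic groups of prime power order *)

Lemma card_generating_pairs1 (gT : finGroupType) :
  #|generating_pairs (1 : {set gT})| = 1%N.
Proof.
apply/eqP/cards1P; exists (1, 1); apply/setP=> -[x y]; rewrite !inE xpair_eqE.
apply/eqP/andP => [xy1|[/eqP-> /eqP->]]; last by rewrite setUid; exact: (genGid 1%G).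
by rewrite -!in_set1 -[[set 1]]xy1 !mem_gen ?set21 ?set22.
Qed.

(** The subgroups of [M] form a chain with [K] just below the top, so a pair in [M] fails to
    generate [M] exactly when it lies in [K]. *)
Lemma card_generating_pairs_cyclic (gT : finGroupType) (A K M : {group gT})
    (p k : nat) :
    prime p -> cyclic A -> K \subset A -> M \subset A ->
    #|K| = (p ^ k)%N -> #|M| = (p ^ k.+1)%N ->
  #|generating_pairs M| = (p ^ k.+1.*2 - p ^ k.*2)%N.
Proof.
move=> p_pr cycA sKA sMA cK cM.
have sKM : K \subset M.
  by rewrite -(cardSg_cyclic cycA) // cK cM expnS dvdn_mull.
have -> : generating_pairs M = setX M M :\: setX K K.
  apply/setP=> -[x y]; rewrite inE in_setD !in_setX /=.
  have [/andP[xM yM]|nM] := boolP ((x \in M) && (y \in M)); last first.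
    rewrite andbF; apply: contraNF nM => /eqP<-.
    by rewrite !mem_gen ?set21 ?set22.
  have sxyM : <<[set x; y]>> \subset M by rewrite gen_subG subUset !sub1set xM.
  rewrite andbT -!sub1set -subUset -gen_subG.
  apply/idP/idP => [/eqP->|].
    by rewrite -(cardSg_cyclic cycA) // cK cM dvdn_Pexp2l ?prime_gt1 // ltnn.
  have /(dvdn_pfactor _ _ p_pr)[j le_j cj] : #|<<[set x; y]>>| %| p ^ k.+1.
    by rewrite -cM cardSg.
  (* Inside the cyclic group [A], inclusion is divisibility of orders: not lying in [K] forces
     [k < j], and then the order is that of [M]. *)
  rewrite -(cardSg_cyclic cycA) ?(subset_trans sxyM) // cj cK.
  rewrite dvdn_Pexp2l ?prime_gt1 // -ltnNge => lt_kj.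
  rewrite eqEcard sxyM cM /= cj leq_pexp2l ?prime_gt0 //.
rewrite cardsD (setIidPr _) ?setXS // !cardsX cK cM.
by rewrite -!expnD !addnn.
Qed.

(** * Classification of the subgroups of the dihedral group *)

Section DihedralSubgroups.

Variables (p : nat) (gT : finGroupType) (G : {group gT}) (a b : gT).
Hypotheses (p_pr : prime p) (oa : #[a] = (p ^ 2)%N) (bGA : b \in G :\: <[a]>)
  (b2 : b ^+ 2 = 1) (ab : a ^ b = a^-1) (defG : <[a]> * <[b]> = G).

Let A := <[a]>%G.

Lemma rotation_sub : A \subset G.
Proof. by rewrite -defG mulG_subl. Qed.

Lemma reflectionP t : t \in G :\: A -> exists m, t = a ^+ m * b.
Proof.
rewrite inE -[in X in _ && X]defG => /andP[tNA /mulsgP[u v /cycleP[m uE] vb tE]].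
have [vE|vE] := mem_cycle_expg2 b2 vb; last by exists m; rewrite -uE -vE.
by case/negP: tNA; rewrite tE vE mulg1 uE mem_cycle.
Qed.

Lemma reflection_mem m : a ^+ m * b \in G :\: A.
Proof.
case/setDP: bGA => bG bNA.
by rewrite inE groupMl ?mem_cycle // bNA groupM // (subsetP rotation_sub) ?mem_cycle.
Qed.

(** The factor [a ^+ m] of a reflection commutes with [A], so only [b] acts. This and the next two
    lemmas supply the hypotheses on an inverting coset. *)
Lemma reflection_inv : {in G :\: A & A, forall t x, x ^ t = x^-1}.
Proof.
move=> _ x /reflectionP[m ->] /cycleP[i ->].
rewrite conjgM (conjgE _ (a ^+ m)) (commuteX2 _ _ (commute_refl a)) mulKg.
by rewrite conjXg ab expgVn.
Qed.

Lemma reflection_invol : {in G :\: A, forall t, t ^+ 2 = 1}.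
Proof.
move=> _ /reflectionP[m ->]; have := conjgE (a ^+ m) b.
rewrite (invg_expg2 b2) conjXg ab expgVn => abE.
by rewrite expgS expg1 -mulgA -abE mulgV.
Qed.

Lemma reflection_gen : {in G :\: A, forall t, A * <[t]> = G}.
Proof.
move=> t tGA; have nAt := inverting_norm reflection_inv (subxx A) tGA.
apply/eqP; rewrite eqEsubset -(norm_joinEr nAt) join_subG rotation_sub.
rewrite cycle_subG; case/setDP: (tGA) => -> _ /=.
have [m tE] := reflectionP tGA; rewrite -defG mul_subG ?joing_subl // cycle_subG.
rewrite -(mulKg (a ^+ m) b) -tE groupM ?groupV //.
  by rewrite (subsetP (joing_subl _ _)) ?mem_cycle.
by rewrite (subsetP (joing_subr _ _)) ?cycle_id.
Qed.

(** The exponent makes the order [p ^ k] for [k <= 2]; beyond that, truncated subtraction gives all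
    of [A]. *)
Definition rot k := <[a ^+ (p ^ (2 - k))]>%G.

Lemma rot_sub k : rot k \subset A.
Proof. exact: cycleX. Qed.

Lemma card_rot k : k <= 2 -> #|rot k| = (p ^ k)%N.
Proof.
move=> k2; rewrite -orderE orderXdiv oa ?dvdn_exp2l ?leq_subr //.
by rewrite -expnB ?leq_subr ?prime_gt0 // subKn.
Qed.

Lemma subgroup_rot (H : {group gT}) :
  H \subset A -> exists2 k, k <= 2 & H = rot k.
Proof.
move=> sHA; have /(dvdn_pfactor _ _ p_pr)[k k2 cH] : #|H| %| p ^ 2.
  by rewrite -oa cardSg.
exists k => //; apply/val_inj/eqP => /=.
by rewrite (eq_subG_cyclic (cycle_cyclic a)) ?rot_sub // cH card_rot.
Qed.

Definition dih k i := (rot k <*> <[a ^+ i * b]>)%G.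

Lemma dih_cap k i : A :&: dih k i = rot k.
Proof.
exact: (joing_coset_cap reflection_invol reflection_inv (rot_sub k)
  (reflection_mem i)).
Qed.

Lemma mem_dih k i : a ^+ i * b \in dih k i.
Proof. by rewrite (subsetP (joing_subr _ _)) ?cycle_id. Qed.

Lemma dih_subN k i : (dih k i \subset A) = false.
Proof.
apply/negbTE/subsetPn; exists (a ^+ i * b); first exact: mem_dih.
by case/setDP: (reflection_mem i).
Qed.

Lemma rot_subG k : rot k \subset G.
Proof. exact: subset_trans (rot_sub k) rotation_sub. Qed.

Lemma dih_subG k i : dih k i \subset G.
Proof.
by rewrite join_subG rot_subG cycle_subG; case/setDP: (reflection_mem i).
Qed.

Lemma subgroup_dih (H : {group gT}) : H \subset G -> ~~ (H \subset A) ->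
  exists k i, [/\ k <= 2, i < p ^ (2 - k) & H = dih k i].
Proof.
move=> sHG /subsetPn[t tH tNA].
have [|m tE] := reflectionP (t := t); first by rewrite inE tNA (subsetP sHG).
have [k k2 /(congr1 val)/= capH] := @subgroup_rot (A :&: H)%G (subsetIl _ _).
set n := (p ^ (2 - k))%N in capH.
have n_gt0 : 0 < n by rewrite expn_gt0 prime_gt0.
exists k, (m %% n)%N; rewrite ltn_mod; split=> //.
have /setIP[_ rH] : a ^+ n \in A :&: H by rewrite capH cycle_id.
apply/val_inj; rewrite /= -[X in X <*> _]capH; apply/esym.
apply: (coset_joing_cap reflection_inv reflection_gen) => //.
case/setDP: (reflection_mem (m %% n)) => _ sNA; rewrite inE sNA /=.
(* As [a ^+ n] lies in [H], the exponent of the reflection [t] can be reduced modulo [n] without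
   leaving [H]. *)
have -> : a ^+ (m %% n) * b = (a ^+ n) ^- (m %/ n) * t.
  have aE : a ^+ m = (a ^+ n) ^+ (m %/ n) * a ^+ (m %% n).
    by rewrite -expgM -expgD mulnC -divn_eq.
  by rewrite tE aE -mulgA mulKg.
by apply: groupM => //; rewrite groupV groupX.
Qed.

(** The quotient of the two reflections is a rotation in the common group, hence a power of
    [a ^+ n]. So [i] and [j] agree modulo [n], a divisor of the order of [a]. *)
Lemma dih_inj k i j : k <= 2 -> i < p ^ (2 - k) -> j < p ^ (2 - k) ->
  dih k i = dih k j -> i = j.
Proof.
move=> k2 lti ltj eq_ij; set n := (p ^ (2 - k))%N in lti ltj *.
have : a ^+ i * a ^- j \in rot k.
  rewrite -(dih_cap k i); apply/setIP; split.
    by rewrite groupM ?groupV ?mem_cycle.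
  have -> : a ^+ i * a ^- j = (a ^+ i * b) * (a ^+ j * b)^-1.
    by rewrite invMg mulgA mulgK.
  by apply: groupM; rewrite ?groupV ?mem_dih // eq_ij mem_dih.
case/cycleP=> m; rewrite -expgM => /(canRL (mulgKV _)); rewrite -expgD.
move/eqP; rewrite eq_expg_mod_order oa => /eqP/(congr1 (modn^~ n)).
rewrite !modn_dvdm ?dvdn_exp2l ?leq_subr //.
by rewrite mulnC modnMDl !modn_small.
Qed.

Lemma card_generating_pairs_rot k : k <= 1 ->
  #|generating_pairs (rot k.+1)| = (p ^ k.+1.*2 - p ^ k.*2)%N.
Proof.
move=> k1; apply: (card_generating_pairs_cyclic p_pr (cycle_cyclic a)
  (rot_sub k) (rot_sub k.+1)); by rewrite card_rot // ltnW.
Qed.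

Lemma card_generating_pairs_dih k i : k <= 2 ->
  #|generating_pairs (dih k i)| = (3 * (p ^ k * totient (p ^ k)))%N.
Proof.
move=> k2; rewrite (card_generating_pairs_coset reflection_invol
  reflection_inv reflection_gen (cycle_cyclic a) (dih_subG k i)) ?dih_subN //.
by rewrite dih_cap card_rot.
Qed.

(** * Coding the subgroups and matching them with the stars *)

(* A triple [(c, k, i)] stands for the rotation group of order [p ^ k] if [c],
   and otherwise for its extension by the reflection [a ^+ i * b]. *)
Definition code_subgroup (c : bool * nat * nat) : subgroup_vertex G :=
  let: (c, k, i) := c in
  if c then Sub (rot k) (rot_subG k) else Sub (dih k i) (dih_subG k i).

(** Rotation groups carry the dummy index 0, so that each subgroup has a single valid code. *)
Definition valid_code (c : bool * nat * nat) : bool :=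
  let: (c, k, i) := c in
  (k <= 2) && (if c then i == 0%N else i < p ^ (2 - k)).

Lemma code_subgroup_inj : {in valid_code &, injective code_subgroup}.
Proof.
have rot_inj k k' : k <= 2 -> k' <= 2 -> rot k = rot k' :> {set gT} -> k = k'.
  move=> k2 k'2 /(congr1 (fun X : {set gT} => #|X|)); rewrite !card_rot // => /eqP.
  by rewrite eqn_exp2l ?prime_gt1 // => /eqP.
move=> [[c k] i] [[c' k'] i'] /andP[k2 hi] /andP[k'2 hi'].
case: c hi; case: c' hi' => hi' hi /(congr1 val) /= eqH.
- rewrite (eqP hi) (eqP hi'); congr (_, _, _).
  by apply: rot_inj => //; rewrite eqH.
- by have := dih_subN k' i'; rewrite -eqH rot_sub.
- by have := dih_subN k i; rewrite eqH rot_sub.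
have kk : k = k' by apply: rot_inj; rewrite // -(dih_cap k i) eqH dih_cap.
by move: hi hi' eqH; rewrite -kk => hi hi' /dih_inj->.
Qed.

Lemma code_subgroup_surj H : exists2 c, valid_code c & H = code_subgroup c.
Proof.
case: H => H sHG; have [sHA|nsHA] := boolP (H \subset A).
  have [k k2 defH] := subgroup_rot sHA; exists (true, k, 0%N); first by rewrite /= k2.
  by apply: val_inj.
have [k [i [k2 lti defH]]] := subgroup_dih sHG nsHA.
by exists (false, k, i); [rewrite /= k2 | apply: val_inj].
Qed.

(** The shape that [star_forest_gunion] and [star_forest_copies] give to the index type of the
    right-hand graph, one summand per term. *)
Definition star_index : finType :=
  (unit + 'I_(p ^ 2) * unit + unit + unit + 'I_p * unit + unit)%type.

(** In the order of the terms: the trivial group, the [p ^ 2] groups generated by a reflection,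
    [<[a ^+ p]>], [<[a]>], the [p] dihedral groups of order [2p], and [G]. *)
Definition star_code (j : star_index) : bool * nat * nat :=
  match j with
  | inl (inl (inl (inl (inl _)))) => (true, 0, 0)
  | inl (inl (inl (inl (inr (i, _))))) => (false, 0, nat_of_ord i)
  | inl (inl (inl (inr _))) => (true, 1, 0)
  | inl (inl (inr _)) => (true, 2, 0)
  | inl (inr (i, _)) => (false, 1, nat_of_ord i)
  | inr _ => (false, 2, 0)
  end%N.

Lemma star_code_valid j : valid_code (star_code j).
Proof. by case: j => [[[[[[]|[[i lti] []]]|[]]|[]]|[[i lti] []]]|[]]. Qed.

Lemma star_code_inj : injective star_code.
Proof.
move=> [[[[[[]|[i []]]|[]]|[]]|[i []]]|[]] [[[[[[]|[j []]]|[]]|[]]|[j []]]|[]] //.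
  by case=> /val_inj->.
by case=> /val_inj->.
Qed.

Lemma star_code_surj c : valid_code c -> exists j, star_code j = c.
Proof.
case: c => [[[] [|[|[|k]]]] i] //= hi.
- by rewrite (eqP hi); exists (inl (inl (inl (inl (inl tt))))).
- by rewrite (eqP hi); exists (inl (inl (inl (inr tt)))).
- by rewrite (eqP hi); exists (inl (inl (inr tt))).
- by exists (inl (inl (inl (inl (inr (Ordinal hi, tt)))))).
- by exists (inl (inr (Ordinal hi, tt))).
(* For [k = 2] the bound on [i] is [p ^ 0 = 1]. *)
by case: i hi => // _; exists (inr tt).
Qed.

Lemma star_subgroup_bij : bijective (code_subgroup \o star_code).
Proof.
have surj H : exists j, code_subgroup (star_code j) == H.
  have [c /star_code_surj[j <-] ->] := code_subgroup_surj H.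
  by exists j.
have inj : injective (code_subgroup \o star_code).
  move=> j j' /= /code_subgroup_inj e; apply/star_code_inj/e; exact: star_code_valid.
exists (fun H => xchoose (surj H)) => [j|H]; last exact/eqP/(xchooseP (surj H)).
by apply: inj; apply/eqP/(xchooseP (surj _)).
Qed.

End DihedralSubgroups.

(* Comparison of the two star forests *)
Local Close Scope group_scope.

Theorem theorem4p2 (p : nat) (gT : finGroupType) (G : {group gT}) :
  prime p ->
  (G \isog Grp (a : b : a ^+ (p ^ 2), b ^+ 2, b * a * b = a^-1))%g ->
  giso (bgraph G)
    (complete 2
     |+| copies (p ^ 2) (star 3)
     |+| star (p ^ 2 - 1)
     |+| star (p ^ 4 - p ^ 2)
     |+| copies p (star (3 * p * (p - 1)))
     |+| star (3 * p ^ 2 * (p ^ 2 - p)))%SG.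
Proof.
move=> p_pr isoG.
have [|a [b [oa bGA b2 ab defG]]] := isoGrp_dihedral_generators _ isoG.
  by rewrite -(exp1n 2) ltn_exp2r // prime_gt1.
have forestT := star_forest_gunion (star_forest_gunion (star_forest_gunion
  (star_forest_gunion (star_forest_gunion star_forest_K2
    (star_forest_copies (p ^ 2) (star_forest_star 3)))
    (star_forest_star (p ^ 2 - 1))) (star_forest_star (p ^ 4 - p ^ 2)))
    (star_forest_copies p (star_forest_star (3 * p * (p - 1)))))
  (star_forest_star (3 * p ^ 2 * (p ^ 2 - p))).
apply: star_forest_iso forestT.
(* Indexing the subgroups by [star_index] leaves one equality of star sizes for each term. *)
apply: (star_forest_reindex
  (star_subgroup_bij p_pr oa bGA b2 ab defG)) (star_forest_bgraph G).
have pairs_dih := card_generating_pairs_dih p_pr oa bGA b2 ab defG.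
have pairs_rot := card_generating_pairs_rot p_pr oa.
case=> [[[[[[]|[i []]]|[]]|[]]|[i []]]|[]] /=.
- have -> : rot p a 0 = 1%g :> {set gT}.
    by apply/trivgP; rewrite subG1 trivg_card1 (card_rot p_pr oa).
  exact: card_generating_pairs1.
- by rewrite pairs_dih.
- by rewrite pairs_rot.
- by rewrite pairs_rot.
- by rewrite pairs_dih // expn1 totient_prime // subn1 mulnA.
(* The totient of [p ^ 2] is [(p - 1) * p = p ^ 2 - p]. *)
by rewrite pairs_dih // totient_pfactor // mulnA expn1 -subn1 mulnBl mul1n mulnn.
Qed.
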